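(* Let $d\in\mathbb{N}$, $\alpha,\gamma,\nu\in(0,\infty)$, $\xi\in\mathbb{R}^d$, let $\|\cdot\|\colon\mathbb{R}^d\to[0,\infty)$ be the $d$-dimensional Euclidean norm, let $(\Omega,\mathcal{F},\mathbb{P})$ be a probability space, and let $X_n\colon\Omega\to\mathbb{R}^d$, $n\in\mathbb{N}$, be i.i.d. random variables with $\mathbb{E}[\|X_1\|^2]<\infty$ and $\mathbb{P}(X_1=\mathbb{E}[X_1])<1$. For all $\varepsilon\in(0,\infty)$, $i\in\{0,1\}$ let $$r_{\varepsilon,i}=\begin{cases}\nu/2 & \text{if } \nu<1,\\ \min\{1/2,\ \gamma\alpha+(-1)^i\varepsilon\} & \text{if } \nu=1,\\ 0 & \text{if } \nu>1.\end{cases}$$ Let $F\colon\mathbb{R}^d\times\mathbb{R}^d\to\mathbb{R}$ and $f\colon\mathbb{R}^d\to\mathbb{R}$ satisfy for all $\theta,x\in\mathbb{R}^d$ that $F(\theta,x)=\frac{\alpha}{2}\|\theta-x\|^2$ and $f(\theta)=\mathbb{E}[F(\theta,X_1)]$, and let $\Theta\colon\mathbb{N}_0\times\Omega\to\mathbb{R}^d$ be the stochastic process which satisfies for all $n\in\mathbb{N}$ that $\Theta_0=\xi$ and $\Theta_n=\Theta_{n-1}-\frac{\gamma}{n^\nu}(\nabla_\theta F)(\Theta_{n-1},X_n)$. Then (i) there exists a unique $\vartheta\in\mathbb{R}^d$ such that $\{\theta\in\mathbb{R}^d\colon f(\theta)=\inf_{w\in\mathbb{R}^d}f(w)\}=\{\vartheta\}$,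 (ii) for every $\varepsilon\in(0,\infty)$ there exist $c_0,c_1\in(0,\infty)$ such that for all $n\in\mathbb{N}$ it holds that $$c_0\,n^{-r_{\varepsilon,0}}\le\big(\mathbb{E}[\|\Theta_n-\vartheta\|^2]\big)^{1/2}\le c_1\,n^{-r_{\varepsilon,1}},$$ and (iii) for every $\varepsilon\in(0,\infty)$ there exist $C_0,C_1\in(0,\infty)$ such that for all $n\in\mathbb{N}$ it holds that $$C_0\,n^{-2r_{\varepsilon,0}}\le\mathbb{E}[f(\Theta_n)]-f(\vartheta)\le C_1\,n^{-2r_{\varepsilon,1}}.$$
   Context: $\mathbb{N}=\{1,2,3,\ldots\}$ and $\mathbb{N}_0=\mathbb{N}\cup\{0\}$. $\nabla_\theta F$ denotes the gradient of $F(\theta,x)$ with respect to its first argument $\theta$. $\Theta_n$ denotes the random variable $\omega\mapsto\Theta(n,\omega)$. *)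

(* Defs.v *)
From HB Require Import structures.
From mathcomp Require Import all_boot all_order all_algebra.
From mathcomp Require Import all_classical all_reals all_analysis.

Set Implicit Arguments.
Unset Strict Implicit.
Unset Printing Implicit Defensive.

Import Order.TTheory GRing.Theory Num.Theory.
Import numFieldNormedType.Exports.

Local Open Scope classical_set_scope.
Local Open Scope ring_scope.

(* The library norm `|x| on 'rV[R]_d is the maximum norm. *)
Definition enorm (R : realType) (d : nat) (x : 'rV[R]_d) : R :=
  Num.sqrt (\sum_(j < d) x ord0 j ^+ 2).

Definition gradient (R : realType) (d : nat) (g : 'rV[R]_d -> R)
    (t : 'rV[R]_d) : 'rV[R]_d :=
  \row_(j < d) 'D_(delta_mx ord0 j) g t.

(* R^d with its Borel sigma-algebra; the library equips 'rV[R]_d with the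
   product topology but with no measurable structure. *)
Notation borel_rV R d := (g_sigma_algebraType (@open 'rV[R]_d)).

Definition random_vector (disp : measure_display) (T : measurableType disp)
    (R : realType) (d : nat) (X : T -> 'rV[R]_d) : Prop :=
  measurable_fun [set: T] (X : T -> borel_rV R d).

Definition mean_vector (disp : measure_display) (T : measurableType disp)
    (R : realType) (P : probability T R) (d : nat) (X : T -> 'rV[R]_d) :
    'rV[R]_d :=
  \row_(j < d) fine 'E_P[fun w => X w ord0 j].

Definition mutually_independent (disp disp' : measure_display)
    (T : measurableType disp) (U : measurableType disp') (R : realType)
    (P : probability T R) (I : choiceType) (D : set I) (X : I -> T -> U) :
    Prop :=
  forall (J : seq I) (B : I -> set U), uniq J ->
    (forall i, i \in J -> D i) -> (forall i, i \in J -> measurable (B i)) ->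
    P (\bigcap_(i in [set` J]) (X i @^-1` B i)) =
      (\prod_(i <- J) P (X i @^-1` B i))%E.

Definition identically_distributed (disp disp' : measure_display)
    (T : measurableType disp) (U : measurableType disp') (R : realType)
    (P : probability T R) (I : Type) (D : set I) (X : I -> T -> U) : Prop :=
  forall i k, D i -> D k -> forall B : set U, measurable B ->
    P (X i @^-1` B) = P (X k @^-1` B).

Definition iid_random_vectors (disp : measure_display)
    (T : measurableType disp) (R : realType) (P : probability T R) (d : nat)
    (D : set nat) (X : nat -> T -> 'rV[R]_d) : Prop :=
  [/\ forall n, D n -> random_vector (X n),
      mutually_independent P D (X : nat -> T -> borel_rV R d)
    & identically_distributed P D (X : nat -> T -> borel_rV R d)].

Definition rate (R : realType) (alpha gamma nu eps : R) (i : nat) : R :=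
  if nu < 1 then nu / 2
  else if nu == 1 then Num.min (1 / 2) (gamma * alpha + (-1) ^+ i * eps)
  else 0.

(* Main.v *)
(* Put a = gamma alpha, b_n = a n^(-nu), m = E[X_1] and let s be the total
   variance of X_1. Completing the square gives
   f(theta) = alpha/2 (|theta - m|^2 + s), so m is the unique minimiser and
   (iii) is (ii) squared. The error satisfies
   Theta_n - m = (1 - b_n) (Theta_(n-1) - m) + b_n (X_n - m), and as the noise
   is centred and pairwise uncorrelated, e_n = E[|Theta_n - m|^2] obeys the exact
   scalar recursion e_n = (1 - b_n)^2 e_(n-1) + b_n^2 s. Eventual sub- and
   supersolutions of such recursions are ordered up to a constant, and since
   e_n >= b_n^2 s > 0 the finitely many remaining indices only change the
   constant.
   Upper bounds: n^(-p) is a supersolution as soon as p <= min(1, nu) and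
   p / n <= (2 - delta) b_n. Lower bounds: n^(-nu) is a subsolution, n^(-p) is
   one for nu = 1 and 2 a <= p <= 1, and 1 + n^(-q) is one for nu > 1. *)

Require Import Defs.
From HB Require Import structures.
From mathcomp Require Import all_boot all_order all_algebra.
From mathcomp Require Import all_classical all_reals all_analysis.
From mathcomp Require Import measurable_realfun ring lra.

Set Implicit Arguments.
Unset Strict Implicit.
Unset Printing Implicit Defensive.

Import Order.TTheory GRing.Theory Num.Theory.
Import numFieldNormedType.Exports.

Local Open Scope classical_set_scope.
Local Open Scope ring_scope.

(** * Rates of the scalar recursion *)

Section recursion_rates.
Context {R : realType}.
Implicit Types (b u v : nat -> R) (x y p : R).

(** Concavity of [ln] between [y] and [1] with weights [p] and [1 - p], exponentiated. *)
Lemma powR_bernoulli y p : 0 < y -> 0 <= p -> p <= 1 ->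
  y `^ p <= 1 + p * (y - 1).
Proof.
move=> y0 p0 p1.
have := @concave_ln R (Itv01 p0 p1) y 1 y0 ltr01.
rewrite !convRE/= /unstable.onem ln1 mulr0 addr0 -ler_expR -ln_powR.
rewrite lnK ?posrE ?powR_gt0// lnK ?posrE; first by lra.
have := mulr_ge0 p0 (ltW y0);
  move: p1 y0; rewrite le_eqVlt => /predU1P[->|]; nra.
Qed.

(** Bernoulli for the ratio [y / x]. With [x], [y] consecutive integers, in either order, it
    controls one step of [n^(-p)]: the relative change is at most [- p / (n + 1)] going up and
    [p / n] going down. *)
Lemma powRN_ratio_le x y p : 0 < x -> 0 < y -> 0 <= p -> p <= 1 ->
  x `^ (- p) <= y `^ (- p) * (1 + p * (y / x - 1)).
Proof.
move=> x0 y0 p0 p1.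
have -> : x `^ (- p) = y `^ (- p) * (y / x) `^ p.
  rewrite powRM ?invr_ge0 ?ltW// mulrA -powRD;
    last by rewrite (gt_eqF y0) implybT.
  by rewrite addNr powRr0 mul1r -powR_inv1 ?ltW// -powRrM mulN1r.
by rewrite ler_wpM2l ?powR_ge0// powR_bernoulli ?divr_gt0.
Qed.

Lemma near_powR_ge p (M : R) : 0 < p -> \forall n \near \oo, M <= n%:R `^ p.
Proof.
move=> p0; near=> n.
have [M0|M0] := leP M 0; first by rewrite (le_trans M0) ?powR_ge0.
have -> : M = (M `^ p^-1) `^ p by rewrite -powRrM mulVf ?gt_eqF ?powRr1 ?ltW.
apply: ge0_ler_powR; rewrite ?nnegrE ?powR_ge0 ?ler0n ?ltW//.
by near: n; apply: nbhs_infty_gtr.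
Unshelve. all: by end_near. Qed.

(** The threshold descends one index at a time; each index gained shrinks [c] to at most the ratio
    [v N / u N] there. *)
Lemma eventual_lower_bound u v :
    (forall n, (0 < n)%N -> 0 < u n) -> (forall n, (0 < n)%N -> 0 < v n) ->
    (exists2 c, 0 < c & \forall n \near \oo, c * u n <= v n) ->
  exists2 c, 0 < c & forall n, (0 < n)%N -> c * u n <= v n.
Proof.
move=> u0 v0 [c c0 [N _ cuv]].
elim: N c c0 cuv => [|N IH] c c0 cuv; first by exists c => // n _; exact: cuv.
(* Positivity starts at index 1, so the descent stops at threshold 1. *)
have [N0|N0] := posnP N.
  by exists c => // n n0; apply: cuv => /=; rewrite N0.
apply: (IH (Num.min c (v N / u N))).
  by rewrite lt_min c0 divr_gt0 ?u0 ?v0.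
move=> n /=; rewrite leq_eqVlt => /predU1P[<-|Nn].
  by rewrite -ler_pdivlMr ?u0// ge_min lexx orbT.
apply: le_trans (cuv _ Nn); rewrite ler_wpM2r ?ge_min ?lexx//.
by rewrite ltW// u0// (leq_ltn_trans _ Nn).
Qed.

(** The map [x |-> (1 - b)^2 x + noise] is monotone because its slope is a square, so [c * u <= v]
    propagates once it holds at one index and [c * K <= L]. The sequence [e] later plays [v] for
    lower bounds and [u] for upper bounds. *)
Lemma recursion_comparison b u v (K L : R) :
    0 <= K -> 0 < L ->
    (forall n, (0 < n)%N -> 0 < u n) -> (forall n, (0 < n)%N -> 0 < v n) ->
    (\forall n \near \oo,
       u n.+1 <= (1 - b n.+1) ^+ 2 * u n + K * b n.+1 ^+ 2) ->
    (\forall n \near \oo,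
       (1 - b n.+1) ^+ 2 * v n + L * b n.+1 ^+ 2 <= v n.+1) ->
  exists2 c, 0 < c & forall n, (0 < n)%N -> c * u n <= v n.
Proof.
move=> K0 L0 u0 v0 [Nu _ hu] [Nv _ hv].
apply: eventual_lower_bound => //.
pose N := maxn 1 (maxn Nu Nv).
have N0 : (0 < N)%N by rewrite leq_maxl.
(* The first entry starts the induction at [N], the second orders the noise terms; [K + 1] keeps the
   quotient meaningful for [K = 0]. *)
pose c := Num.min (v N / u N) (L / (K + 1)).
have K1 : 0 < K + 1 by lra.
have c0 : 0 < c by rewrite lt_min !divr_gt0 ?u0 ?v0.
have cK : c * K <= L.
  apply: (@le_trans _ _ (c * (K + 1))); first by rewrite ler_wpM2l ?ltW ?ltrDl.
  by rewrite -ler_pdivlMr// ge_min lexx orbT.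
exists c => //; exists N => // n /=.
elim: n => [|n IH]; first by rewrite leqn0 => /eqP NE; rewrite NE in N0.
rewrite leq_eqVlt => /predU1P[<-|];
  first by rewrite -ler_pdivlMr ?u0// ge_min lexx.
rewrite ltnS => Nn; have {}IH := IH Nn.
have un : (Nu <= n)%N by rewrite (leq_trans _ Nn)// !leq_max leqnn orbT.
have vn : (Nv <= n)%N by rewrite (leq_trans _ Nn)// !leq_max leqnn !orbT.
apply: le_trans (hv _ vn).
apply: le_trans (ler_wpM2l (ltW c0) (hu _ un)) _.
rewrite mulrDr mulrCA [c * (K * _)]mulrA.
by apply: lerD; rewrite ?ler_wpM2l ?ler_wpM2r ?sqr_ge0.
Qed.

(** * Sub- and supersolutions for the step sizes [a n^(-nu)] *)

Section step_sizes.
Variables (a nu s : R) (e : nat -> R).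
Hypotheses (a0 : 0 < a) (nu0 : 0 < nu) (s0 : 0 < s).
Hypothesis e0 : 0 <= e 0%N.
Let b n := a / n%:R `^ nu.
Hypothesis eS : forall n, e n.+1 = (1 - b n.+1) ^+ 2 * e n + b n.+1 ^+ 2 * s.

Let nat0 n : 0 < n.+1%:R :> R. Proof. by rewrite ltr0n. Qed.

Let b_gt0 n : 0 < b n.+1.
Proof. by rewrite divr_gt0// powR_gt0. Qed.

Let bE n : b n = a * n%:R `^ (- nu).
Proof. by rewrite powRN. Qed.

Let b_small (M : R) : 0 < M -> \forall n \near \oo, b n.+1 <= M.
Proof.
move=> M0; near=> n.
rewrite ler_pdivrMr ?powR_gt0// mulrC -ler_pdivrMr//.
have /le_trans : a / M <= n%:R `^ nu by near: n; exact: near_powR_ge.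
by apply; rewrite ge0_ler_powR ?nnegrE ?ler_nat// ltW.
Unshelve. all: by end_near. Qed.

Let e_ge0 n : 0 <= e n.
Proof.
elim: n => [|n IH]//; rewrite eS addr_ge0// mulr_ge0 ?sqr_ge0//.
exact: ltW.
Qed.

Lemma recursion_gt0 n : (0 < n)%N -> 0 < e n.
Proof.
case: n => // n _; rewrite eS; apply: ltr_wpDl;
  first by rewrite mulr_ge0 ?sqr_ge0 ?e_ge0.
by rewrite mulr_gt0// exprn_gt0.
Qed.

(** With [x = (n + 1)^(-nu)] the step is [b = a x], and [K = 2 / a] turns the noise into [2 a x^2],
    exactly the first-order contraction loss [2 b x]. *)
Lemma recursion_lower_nu :
  exists2 c, 0 < c & forall n, (0 < n)%N -> c * n%:R `^ (- nu) <= e n.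
Proof.
apply: (@recursion_comparison b _ _ (2 / a) s) => //.
- by rewrite divr_ge0 ?ltW.
- by case=> // n _; rewrite powR_gt0.
- exact: recursion_gt0.
- near=> n.
  have : n.+1%:R `^ (- nu) <= n%:R `^ (- nu).
    rewrite !powRN lef_pV2 ?posrE ?powR_gt0// ?ltr0n;
      last by near: n; exact: nbhs_infty_gt.
    by rewrite ge0_ler_powR ?nnegrE ?ler_nat// ltW.
  set x : R := _ `^ _; set y : R := _ `^ _ => xy.
  have bx : b n.+1 = a * x by rewrite bE.
  rewrite bx.
  have -> : 2 / a * (a * x) ^+ 2 = 2 * a * x ^+ 2 by field; rewrite gt_eqF.
  have : 0 <= (1 - a * x) ^+ 2 * (y - x) by rewrite mulr_ge0 ?sqr_ge0 ?subr_ge0.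
  have : 0 <= x * (a * x) ^+ 2 by rewrite mulr_ge0 ?sqr_ge0 ?powR_ge0.
  lra.
- by near=> n; rewrite eS [_ * s]mulrC.
Unshelve. all: by end_near. Qed.

(** Contraction alone suffices, hence [K = 0]: one step shrinks [n^(-p)] by a factor of at most
    [1 - p / (n + 1)], which is below [1 - 2 b] and so below [(1 - b)^2]. *)
Lemma recursion_lower_nu1 p : nu = 1 -> 2 * a <= p -> p <= 1 ->
  exists2 c, 0 < c & forall n, (0 < n)%N -> c * n%:R `^ (- p) <= e n.
Proof.
move=> nu1 ap p1; have p0 : 0 <= p by have := a0; lra.
apply: (@recursion_comparison b _ _ 0 s) => //.
- by case=> // n _; rewrite powR_gt0.
- exact: recursion_gt0.
- near=> n; rewrite mul0r addr0.
  have n0 : 0 < n%:R :> R by rewrite ltr0n; near: n; exact: nbhs_infty_gt.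
  apply: (le_trans (powRN_ratio_le (nat0 n) n0 p0 p1)).
  rewrite mulrC ler_wpM2r ?powR_ge0//.
  rewrite /b nu1 powRr1// -natr1.
  have m0 : 0 < n%:R + 1 :> R by lra.
  have -> : n%:R / (n%:R + 1) - 1 = - (n%:R + 1)^-1 :> R
    by field; rewrite gt_eqF.
  have : 0 < (n%:R + 1)^-1 :> R by rewrite invr_gt0.
  set z := _^-1 => z0.
  have : 0 <= (a * z) ^+ 2 by exact: sqr_ge0.
  have : 2 * a * z <= p * z by rewrite ler_wpM2r// ltW.
  nra.
- by near=> n; rewrite eS [_ * s]mulrC.
Unshelve. all: by end_near. Qed.

(* The comparison sequence [1 + n^-q] decreases by about [q n^(- 1 - q)], which
   dominates the contraction defect [2 b_n] as soon as [1 + 2 q <= nu]. *)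
Lemma recursion_lower_cst : 1 < nu ->
  exists2 c, 0 < c & forall n, (0 < n)%N -> c <= e n.
Proof.
move=> nu1.
pose q := Num.min 1 ((nu - 1) / 2).
have q0 : 0 < q by rewrite lt_min ltr01/=; lra.
have q1 : q <= 1 by rewrite ge_min lexx.
have q2 : 1 + 2 * q <= nu.
  have : q <= (nu - 1) / 2 by rewrite ge_min lexx orbT.
  lra.
have [c c0 ce] : exists2 c, 0 < c &
    forall n, (0 < n)%N -> c * (1 + n%:R `^ (- q)) <= e n.
  apply: (@recursion_comparison b _ _ 0 s); [by []|by []|..].
  - by move=> n _; rewrite ltr_pwDl ?powR_ge0.
  - exact: recursion_gt0.
  - near=> n; rewrite mul0r addr0.
    have n1 : 1 <= n%:R :> R by rewrite ler1n; near: n; exact: nbhs_infty_gt.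
    have n0 : 0 < n%:R :> R by lra.
    have := powRN_ratio_le (nat0 n) n0 (ltW q0) q1.
    have M : 4 * a / q <= n.+1%:R `^ q.
      apply: (@le_trans _ _ (n%:R `^ q)); first by near: n; exact: near_powR_ge.
      by rewrite ge0_ler_powR ?nnegrE ?ler_nat// ltW.
    have y1 : n%:R `^ (- q) <= 1.
      by rewrite -[leRHS](powRr0 n%:R) ler_powR// oppr_le0 ltW.
    have y0 : 0 < n%:R `^ (- q) by rewrite powR_gt0.
    have x0 : 0 < n.+1%:R `^ (- q) :> R by rewrite powR_gt0.
    (* As [y <= 1], the defect [2 b (1 + y)] is at most [4 b]. Of the decay of [b], one factor
       [n^(-q)] absorbs the constant [4 a / q] and the rest matches the decrease of [n^(-q)]. *)
    have bq : 4 * b n.+1 <= q * (n.+1%:R `^ (- q) / n.+1%:R).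
      apply: (@le_trans _ _ (4 * (a * n.+1%:R `^ (- (1 + 2 * q))))).
        by rewrite bE ler_wpM2l// ler_wpM2l ?(ltW a0)// ler_powR ?ler1n// lerN2.
      rewrite (_ : - (1 + 2 * q) = - q + - q + -1); last by ring.
      rewrite !powRD ?pnatr_eq0 ?implybT// powR_inv1//.
      rewrite !mulrA ler_wpM2r ?invr_ge0// ler_wpM2r ?powR_ge0//.
      by rewrite powRN ler_pdivrMr ?powR_gt0// [leRHS]mulrC -ler_pdivrMr.
    have -> : n%:R / n.+1%:R - 1 = - n.+1%:R^-1 :> R.
      by rewrite -natr1; field; rewrite natr1 pnatr_eq0.
    have := b_gt0 n.
    have : 0 < n.+1%:R^-1 :> R by rewrite invr_gt0.
    move: bq y1 y0 x0; set x := n.+1%:R `^ _; set y := n%:R `^ _.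
    set z := n.+1%:R^-1; set bn := b n.+1 => bq y1 y0 x0 z0 b0 xy.
    have qzy : 0 <= (q * z) * y by rewrite mulr_ge0 ?mulr_ge0 ?ltW.
    have xy' : x <= y by lra.
    have : (q * z) * x <= (q * z) * y by
      rewrite ler_wpM2l// mulr_ge0 ?(ltW q0) ?(ltW z0).
    have : 0 <= bn * (1 - y) by rewrite mulr_ge0 ?subr_ge0 ?(ltW b0).
    have : 0 <= bn ^+ 2 * (1 + y) by rewrite mulr_ge0 ?sqr_ge0// addr_ge0// ltW.
    lra.
  - by near=> n; rewrite eS [_ * s]mulrC.
exists c => // n n0; apply: le_trans (ce n n0).
by rewrite ler_peMr ?(ltW c0)// lerDl powR_ge0.
Unshelve. all: by end_near. Qed.

(** The contraction [2 b] is split: the share [(2 - delta) b] pays for the decay of [n^(-p)], the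
    share [delta b] for the noise, whose coefficient [L = delta / a] fits since [b <= a n^(-p)] by
    [p <= nu]. *)
Lemma recursion_upper p delta : 0 <= p -> p <= 1 -> p <= nu ->
    0 < delta -> delta <= 1 ->
    (\forall n \near \oo, p / n%:R <= (2 - delta) * b n.+1) ->
  exists2 C, 0 < C & forall n, (0 < n)%N -> e n <= C * n%:R `^ (- p).
Proof.
move=> p0 p1 pnu d0 d1 hp.
(* The comparison scales its subsolution, here [e], so the constant gets inverted. *)
suff [c c0 H] : exists2 c, 0 < c &
    forall n, (0 < n)%N -> c * e n <= n%:R `^ (- p).
  by exists c^-1; rewrite ?invr_gt0// => n n0; rewrite ler_pdivlMl ?H.
apply: (@recursion_comparison b _ _ s (delta / a)).
- exact: ltW.
- exact: divr_gt0.
- exact: recursion_gt0.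
- by case=> // n _; rewrite powR_gt0.
- by near=> n; rewrite eS [_ * s]mulrC.
- near=> n.
  have n0 : 0 < n%:R :> R by rewrite ltr0n; near: n; exact: nbhs_infty_gt.
  have := powRN_ratio_le n0 (nat0 n) p0 p1.
  have -> : n.+1%:R / n%:R - 1 = n%:R^-1 :> R.
    by rewrite -natr1; field; rewrite gt_eqF.
  have hpn : p / n%:R <= (2 - delta) * b n.+1 by near: n.
  have b1 : b n.+1 <= 1 by near: n; exact: b_small.
  have b0 := b_gt0 n.
  have bp : b n.+1 <= a * n.+1%:R `^ (- p).
    by rewrite bE ler_wpM2l ?ler_powR ?lerN2 ?ler1n ?(ltW a0).
  have : 0 < n.+1%:R `^ (- p) :> R by rewrite powR_gt0.
  move: hpn b1 b0 bp; set x := n.+1%:R `^ _;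
    set y := n%:R `^ _; set bn := b n.+1.
  set z := p / n%:R => hz b1 b0 bp x0 yx.
  have {}yx : y <= x * (1 + (2 - delta) * bn).
    by apply: le_trans yx _; rewrite ler_wpM2l ?(ltW x0)// lerD2l.
  (* The difference of the two sides reduces to [(1 - delta) b^2 + (2 - delta) b^2 (1 - b)],
     nonnegative for [b <= 1]. *)
  have h1 : (1 - bn) ^+ 2 * y <= x * (1 - delta * bn).
    apply: (@le_trans _ _ ((1 - bn) ^+ 2 * (x * (1 + (2 - delta) * bn)))).
      by rewrite ler_wpM2l ?sqr_ge0.
    rewrite mulrCA ler_wpM2l ?(ltW x0)//.
    have : 0 <= (1 - delta) * bn ^+ 2 by rewrite mulr_ge0 ?sqr_ge0 ?subr_ge0.
    have : 0 <= (2 - delta) * (bn ^+ 2 * (1 - bn)).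
      apply: mulr_ge0; first by lra.
      by rewrite mulr_ge0 ?sqr_ge0 ?subr_ge0.
    nra.
  have h2 : delta / a * bn ^+ 2 <= x * (delta * bn).
    have -> : delta / a * bn ^+ 2 = delta * bn / a * bn by rewrite expr2; ring.
    have -> : x * (delta * bn) = delta * bn / a * (a * x).
      by field; rewrite gt_eqF.
    by rewrite ler_wpM2l// ltW// divr_gt0// mulr_gt0.
  lra.
Unshelve. all: by end_near. Qed.

End step_sizes.
End recursion_rates.

(** [e] models a squared error, while [rate] belongs to its root; hence the doubled exponents. *)
Lemma recursion_rate (R : realType) (alpha gamma nu s eps : R) (e : nat -> R) :
    0 < alpha -> 0 < gamma -> 0 < nu -> 0 < s -> 0 <= e 0%N -> 0 < eps ->
    (forall n, e n.+1 = (1 - gamma * alpha / n.+1%:R `^ nu) ^+ 2 * e n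
                        + (gamma * alpha / n.+1%:R `^ nu) ^+ 2 * s) ->
  exists c0 c1 : R, [/\ 0 < c0, 0 < c1 & forall n, (0 < n)%N ->
    c0 * n%:R `^ (- (2 * rate alpha gamma nu eps 0)) <= e n /\
    e n <= c1 * n%:R `^ (- (2 * rate alpha gamma nu eps 1))].
Proof.
move=> alpha0 gamma0 nu0 s0 e0 eps0 eS.
suff [[c0 c00 H0] [c1 c10 H1]] :
    (exists2 c, 0 < c & forall n, (0 < n)%N ->
      c * n%:R `^ (- (2 * rate alpha gamma nu eps 0)) <= e n) /\
    (exists2 c, 0 < c & forall n, (0 < n)%N ->
      e n <= c * n%:R `^ (- (2 * rate alpha gamma nu eps 1))).
  by exists c0, c1; split => // n n0; split; [exact: H0|exact: H1].
rewrite /rate expr0 expr1 div1r mul1r mulN1r.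
move: eS; set a := gamma * alpha => eS.
have a0 : 0 < a by rewrite mulr_gt0.
have [nu1|nu1|nu1] := ltgtP nu 1.
- rewrite mulrCA divff ?mulr1//; split; first exact: recursion_lower_nu eS.
  apply: (recursion_upper a0 nu0 s0 e0 eS (delta := 1)) => //; try exact: ltW.
  near=> n.
  have n1 : 1 <= n%:R :> R by rewrite ler1n; near: n; exact: nbhs_infty_gt.
  have n0 : 0 < n%:R :> R by lra.
  have N0 : 0 < n.+1%:R :> R by rewrite ltr0n.
  (* The factor 2 pays for replacing [(n + 1)^nu] by [2 n^nu]; the rest is
     [n = n^nu * n^(1 - nu)]. *)
  have M : 2 * nu / a <= n%:R `^ (1 - nu) by near: n; apply: near_powR_ge; lra.
  rewrite (_ : 2 - 1 = 1 :> R) ?mul1r; last by ring.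
  rewrite ler_pdivrMr// mulrAC ler_pdivlMr ?powR_gt0//.
  have nE : n%:R `^ nu * n%:R `^ (1 - nu) = n%:R :> R.
    by rewrite -powRD ?subrKC ?powRr1// ?ltW// gt_eqF ?implybT.
  have N2 : n.+1%:R `^ nu <= 2 * n%:R `^ nu.
    have := powRN_ratio_le n0 N0 (ltW nu0) (ltW nu1).
    have -> : n.+1%:R / n%:R - 1 = n%:R^-1 :> R.
      by rewrite -natr1; field; rewrite gt_eqF.
    rewrite !powRN mulrC ler_pdivlMr ?powR_gt0// mulrC ler_pdivrMr ?powR_gt0//.
    move=> /le_trans; apply; rewrite ler_wpM2r ?powR_ge0//.
    have : nu * n%:R^-1 <= 1 * 1.
      by rewrite ler_pM ?invr_ge0 ?invf_le1 ?(ltW nu0) ?(ltW nu1)// ltW.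
    lra.
  apply: (@le_trans _ _ (nu * (2 * n%:R `^ nu)));
    first by rewrite ler_wpM2l// ltW.
  rewrite -[X in _ <= a * X]nE mulrA mulrC [leRHS]mulrCA ler_wpM2l ?powR_ge0//.
  by rewrite mulrC [leRHS]mulrC -ler_pdivrMr.
- rewrite mulr0 oppr0; split.
    have [c c0 H] := recursion_lower_cst a0 s0 e0 eS nu1.
    by exists c => // n n0; rewrite powRr0 mulr1 H.
  (* For [nu > 1] the rate is 0, so the upper bound is mere boundedness. *)
  have := recursion_upper a0 nu0 s0 e0 eS (p := 0) (delta := 1).
  rewrite oppr0; apply => //; first exact: ltW.
  near=> n; rewrite mul0r mulr_ge0 ?divr_ge0 ?powR_ge0 ?(ltW a0)//; lra.
- split.
    (* If [2 a >= 1] the minimum is [1 / 2] and the noise level [n^(-1)] is the bound; otherwise the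
       doubled rate lies between [2 a] and 1 and contraction decides. *)
    have [a1|a1] := leP 1 (2 * a).
      have -> : 2 * Num.min (2^-1) (a + eps) = nu.
        by rewrite min_l; lra.
      exact: recursion_lower_nu eS.
    apply: (recursion_lower_nu1 a0 s0 e0 eS nu1).
      by rewrite ler_pM2l// le_min; apply/andP; split; lra.
    have : Num.min (2^-1) (a + eps) <= 2^-1 by rewrite ge_min lexx.
    lra.
  (* For [eps > a] the rate is negative; clamping at 0 only strengthens the bound and keeps [p]
     admissible. *)
  pose p := Num.max 0 (2 * Num.min (2^-1) (a - eps)).
  have p0 : 0 <= p by rewrite le_max lexx.
  have m1 : Num.min (2^-1) (a - eps) <= 2^-1 by rewrite ge_min lexx.
  have m2 : Num.min (2^-1) (a - eps) <= a - eps by rewrite ge_min lexx orbT.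
  have p1 : p <= 1 by rewrite ge_max; apply/andP; split; lra.
  have pa : p < 2 * a by rewrite gt_max; apply/andP; split; lra.
  (* At most half of the slack in [p < 2 a]: then [(2 - delta) a >= a + p / 2 > p], and the
     remaining gap absorbs the shift from [n] to [n + 1] once [n >= 2 p / (2 a - p)]. *)
  pose delta := Num.min 1 ((2 * a - p) / (2 * a)).
  have d0 : 0 < delta by rewrite lt_min ltr01 divr_gt0 ?subr_gt0// mulr_gt0.
  have d1 : delta <= 1 by rewrite ge_min lexx.
  have [||C C0 H] := recursion_upper a0 nu0 s0 e0 eS p0 p1 _ d0 d1.
  + by rewrite nu1.
  + near=> n.
    have n0 : 0 < n%:R :> R by rewrite ltr0n; near: n; exact: nbhs_infty_gt.
    have M : 2 * p / (2 * a - p) <= n%:R :> R.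
      by near: n; exact: nbhs_infty_ger.
    rewrite nu1 powRr1// -natr1 mulrA ler_pdivrMr// mulrAC ler_pdivlMr;
      last by lra.
    have : delta * (2 * a) <= 2 * a - p.
      by rewrite -ler_pdivlMr ?mulr_gt0// ge_min lexx orbT.
    move: M; rewrite ler_pdivrMr ?subr_gt0// => M dap.
    apply: (@le_trans _ _ ((a + p / 2) * n%:R)); first by lra.
    by rewrite ler_wpM2r ?(ltW n0)//; lra.
  exists C => // n n0; apply: le_trans (H n n0) _.
  rewrite ler_wpM2l ?(ltW C0)// ler_powR ?ler1n// lerN2.
  by rewrite le_max lexx orbT.
Unshelve. all: by end_near. Qed.

(** * Square-integrable random variables *)

Lemma measurable_rV_coord (R : realType) (d : nat) (j : 'I_d) :
  measurable_fun [set: borel_rV R d] (fun x : 'rV[R]_d => x ord0 j).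
Proof.
apply: (measurability _ (RGenOInfty.measurableE R)).
move=> _ [_ [y ->] <-].
rewrite setTI; apply: sub_sigma_algebra.
apply: open_comp; last exact: interval_open.
by move=> x _; exact: coord_continuous.
Qed.

Section square_integrable.
Context disp (Omega : measurableType disp) (R : realType).
Variable P : probability Omega R.
Implicit Types U V : Omega -> R.

Lemma Lfun2P U : measurable_fun [set: Omega] U ->
  ('E_P[(fun w => U w ^+ 2)%R] < +oo)%E -> U \in Lfun P 2%:E.
Proof.
move=> mU; rewrite unlock => U2.
rewrite inE; apply/andP; split; rewrite inE//=.
rewrite /finite_norm unlock poweR_lty//.
under eq_integral do rewrite /= powR_mulrn// real_normK ?num_real//.
exact: U2.
Qed.

Lemma Lfun21 U : U \in Lfun P 2%:E -> U \in Lfun P 1.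
Proof. exact/Lfun_subset12/fin_num_measure. Qed.

Lemma eq_distribution_expectation U V (g : R -> R) :
    measurable_fun [set: Omega] U -> measurable_fun [set: Omega] V ->
    (forall A, measurable A -> P (U @^-1` A) = P (V @^-1` A)) ->
    measurable_fun [set: R] g ->
    g \o U \in Lfun P 1 -> g \o V \in Lfun P 1 ->
  'E_P[g \o U]%E = 'E_P[g \o V]%E.
Proof.
move=> mU mV UV mg /Lfun1_integrable iU /Lfun1_integrable iV.
have meg : measurable_fun setT (EFin \o g). exact/measurable_EFinP.
rewrite unlock -(integral_pushforward mU meg iU measurableT).
rewrite -(integral_pushforward mV meg iV measurableT).
by apply: eq_measure_integral => A mA _; exact: UV.
Qed.

(** Since the value [+oo] is allowed, this carries finiteness of second moments from [X 1] to every
    [X k]. *)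
Lemma eq_distribution_ge0_expectation U V (g : R -> R) :
    measurable_fun [set: Omega] U -> measurable_fun [set: Omega] V ->
    (forall A, measurable A -> P (U @^-1` A) = P (V @^-1` A)) ->
    measurable_fun [set: R] g -> (forall x, 0 <= g x) ->
  'E_P[g \o U]%E = 'E_P[g \o V]%E.
Proof.
move=> mU mV UV mg g0.
have meg : measurable_fun [set: R] (EFin \o g) by exact/measurable_EFinP.
have eg0 : {in [set: R], forall x, 0 <= (EFin \o g) x}%E.
  by move=> x _; rewrite lee_fin.
rewrite unlock -(ge0_integral_pushforward mU P measurableT meg eg0).
rewrite -(ge0_integral_pushforward mV P measurableT meg eg0).
by apply: eq_measure_integral => A mA _; exact: UV.
Qed.

(* The law of [(U, V)] is the product of the laws of [U] and [V], so Fubini's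
   theorem factorises the expectation. *)
Lemma expectationM_independent U V :
    measurable_fun [set: Omega] U -> measurable_fun [set: Omega] V ->
    (forall A B, measurable A -> measurable B ->
      P (U @^-1` A `&` V @^-1` B) = P (U @^-1` A) * P (V @^-1` B))%E ->
    U \in Lfun P 1 -> V \in Lfun P 1 -> U \* V \in Lfun P 1 ->
  'E_P[U \* V]%E = ('E_P[U] * 'E_P[V])%E.
Proof.
move=> mU mV UV U1 V1 /Lfun1_integrable iUV.
have /Lfun1_integrable iU := U1; have /Lfun1_integrable iV := V1.
pose UF : {mfun Omega >-> R} := HB.pack U (isMeasurableFun.Build _ _ _ _ _ mU).
pose VF : {mfun Omega >-> R} := HB.pack V (isMeasurableFun.Build _ _ _ _ _ mV).
have mW : measurable_fun [set: Omega] (fun w => (U w, V w)).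
  exact/measurable_fun_pair.
pose WF : {mfun Omega >-> (R * R)%type} :=
  HB.pack (fun w => (U w, V w)) (isMeasurableFun.Build _ _ _ _ _ mW).
pose g (z : R * R) := (z.1 * z.2)%:E.
have mg : measurable_fun [set: R * R] g.
  by apply/measurable_EFinP/measurable_funM.
have prodE A : measurable A ->
    (distribution P UF \x distribution P VF)%E A = distribution P WF A.
  apply: product_measure_unique => B C mB mC.
  by rewrite /distribution /pushforward/= -UV.
have gE (f : R * R -> \bar R) : (\int[distribution P WF]_z f z =
    \int[distribution P UF \x distribution P VF]_z f z)%E.
  by apply: eq_measure_integral => A mA _; exact/esym/prodE.
have ig : (distribution P UF \x distribution P VF)%E.-integrable setT g.
  apply/integrableP; split => //.
  rewrite -gE.
  by have /integrableP[] := integrable_pushforward mW mg iUV measurableT.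
rewrite -[in RHS](fineK (expectation_fin_num V1)) unlock.
rewrite -[LHS](integral_pushforward mW mg iUV measurableT).
rewrite [LHS]gE -integral12_prod_meas1//= /fubini_F/=.
under eq_integral => x _.
  rewrite /g/=.
  under eq_integral do rewrite EFinM.
  rewrite integralZl//; last exact: integrable_pushforward.
  rewrite (integral_pushforward mV)//.
  rewrite [X in (_ * X)%E](_ : _ = (fine (\int[P]_w (V w)%:E))%:E); last first.
    by rewrite fineK// integrable_fin_num.
  over.
rewrite integralZr//; last exact: (integrable_pushforward mU).
by rewrite (integral_pushforward mU).
Qed.
End square_integrable.

(** * Second moments under centred, pairwise uncorrelated noise *)

Section stochastic_recursion.
Context disp (Omega : measurableType disp) (R : realType).
Variable P : probability Omega R.
Implicit Types (U V : Omega -> R) (p q : R).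

Lemma Lfun_lin r p q U V : 1 <= r -> U \in Lfun P r%:E -> V \in Lfun P r%:E ->
  (fun w => p * U w + q * V w) \in Lfun P r%:E.
Proof.
move=> r1 Ur Vr.
rewrite (_ : (fun w => _) = (p \o* U)%R \+ (q \o* V)%R); last first.
  by apply/funext => w /=; rewrite [p * _]mulrC [q * _]mulrC.
by apply: rpredD; rewrite ?lee_fin//; apply: Lfun_scale.
Qed.

Lemma expectation_lin p q U V : U \in Lfun P 1 -> V \in Lfun P 1 ->
  'E_P[fun w => (p * U w + q * V w)%R]%E = (p%:E * 'E_P[U] + q%:E * 'E_P[V])%E.
Proof.
move=> U1 V1; rewrite -!expectationZl// -expectationD; [|exact: Lfun_scale..].
by congr expectation; apply/funext => w /=; rewrite [p * _]mulrC [q * _]mulrC.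
Qed.

(** [D n] is a deterministic combination of a constant and [Y 1, ..., Y n], so it is orthogonal to
    every later [Y k] and the cross term of the expanded square vanishes. *)
Lemma second_moment_recursion (b : nat -> R) (s c : R) (e : nat -> R)
    (D Y : nat -> Omega -> R) :
    (forall k, (0 < k)%N -> Y k \in Lfun P 2%:E) ->
    (forall k, (0 < k)%N -> 'E_P[Y k]%E = 0) ->
    (forall k, (0 < k)%N -> 'E_P[Y k \* Y k]%E = s%:E) ->
    (forall k l, (0 < k)%N -> (k < l)%N -> 'E_P[Y k \* Y l]%E = 0) ->
    (forall w, D 0 w = c) ->
    (forall n w, D n.+1 w = (1 - b n.+1) * D n w + b n.+1 * Y n.+1 w) ->
    e 0 = c ^+ 2 ->
    (forall n, e n.+1 = (1 - b n.+1) ^+ 2 * e n + b n.+1 ^+ 2 * s) ->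
  forall n, D n \in Lfun P 2%:E /\ 'E_P[D n \* D n]%E = (e n)%:E.
Proof.
move=> Y2 Y0 Ys Yorth D0 DS e0 eS.
have {}D0 : D 0 = cst c by exact/funext.
have {}DS n : D n.+1 = fun w => (1 - b n.+1) * D n w + b n.+1 * Y n.+1 w.
  exact/funext.
have D2 n : D n \in Lfun P 2%:E.
  elim: n => [|n IH]; first by rewrite D0 Lfun_cst.
  by rewrite DS; apply: Lfun_lin => //; rewrite ?ler1n// Y2.
have Dorth n k : (n < k)%N -> 'E_P[D n \* Y k]%E = 0.
  elim: n => [|n IH] nk.
    rewrite D0 (_ : _ \* _ = c \o* Y k); last first.
      by apply/funext => w /=; rewrite mulrC.
    by rewrite expectationZl ?Y0 ?mule0// Lfun21// Y2.
  have k0 := leq_ltn_trans (leq0n _) nk.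
  rewrite DS.
  rewrite (_ : _ \* _ = fun w => (1 - b n.+1) * (D n \* Y k) w
      + b n.+1 * (Y n.+1 \* Y k) w); last first.
    by apply/funext => w /=; ring.
  rewrite expectation_lin ?Lfun2_mul_Lfun1 ?Y2//.
  by rewrite IH ?(ltnW nk)// Yorth// !mule0 adde0.
elim=> [|n [_ IH]]; split => //.
  rewrite D0 e0 (_ : _ \* _ = cst (c ^+ 2)) ?expectation_cst//.
(* The square is arranged as nested two-term combinations, the shape split by [expectation_lin]. *)
rewrite DS (_ : _ \* _ = fun w => 1 * ((1 - b n.+1) ^+ 2 * (D n \* D n) w
   + b n.+1 ^+ 2 * (Y n.+1 \* Y n.+1) w)
   + (2 * (1 - b n.+1) * b n.+1) * (D n \* Y n.+1) w); last first.
  by apply/funext => w /=; ring.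
have DD1 : D n \* D n \in Lfun P 1 by exact: Lfun2_mul_Lfun1.
have DY1 : D n \* Y n.+1 \in Lfun P 1 by rewrite Lfun2_mul_Lfun1 ?Y2.
have YY1 : Y n.+1 \* Y n.+1 \in Lfun P 1 by rewrite Lfun2_mul_Lfun1 ?Y2.
rewrite expectation_lin//; last exact: Lfun_lin.
rewrite expectation_lin// IH Ys// Dorth// mule0 adde0 mul1e.
by rewrite eS EFinD !EFinM.
Qed.

End stochastic_recursion.

(** * Euclidean norm and gradient of the squared distance *)

Section vectors.
Context {R : realType} {d : nat}.
Implicit Types (x y t : 'rV[R]_d).

Lemma enorm_sqr x : enorm x ^+ 2 = \sum_(j < d) x ord0 j ^+ 2.
Proof. by rewrite sqr_sqrtr// sumr_ge0// => j _; rewrite sqr_ge0. Qed.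

Lemma enorm_eq0 x : (enorm x ^+ 2 == 0) = (x == 0).
Proof.
rewrite enorm_sqr psumr_eq0; last by move=> j _; rewrite sqr_ge0.
apply/allP/eqP => [x0|-> j _]; last by rewrite mxE expr0n/=.
apply/rowP => j; rewrite mxE; apply/eqP.
by have := x0 j (mem_index_enum j); rewrite /= sqrf_eq0.
Qed.

Lemma gradient_sqr_dist (alpha : R) x t :
  gradient (fun theta => alpha / 2 * enorm (theta - x) ^+ 2) t
    = alpha *: (t - x).
Proof.
apply/rowP => j; rewrite !mxE.
apply: cvg_lim => //.
have -> : alpha * (t ord0 j - x ord0 j)
    = alpha * (t ord0 j - x ord0 j) + alpha / 2 * 0 by rewrite mulr0 addr0.
(* For [h != 0] only the [j]-th summand changes, and the difference quotient of this quadratic is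
   exactly affine in [h]. *)
apply: (@cvg_trans _ ((fun h : R => alpha *
  (t ord0 j - x ord0 j) + alpha / 2 * h)
   @ 0^')); last first.
  apply: cvgD; first exact: cvg_cst.
  by apply: cvgMr => //; exact: nbhs_dnbhs.
apply: near_eq_cvg; near=> h.
have h0 : h != 0 by near: h; exact: nbhs_dnbhs_neq.
rewrite /= !enorm_sqr (bigD1 j)//=.
rewrite [\sum_(i < d) (t - x) ord0 i ^+ 2](bigD1 j)//=.
rewrite !mxE !eqxx mulr1.
rewrite (eq_bigr (fun i => (t - x) ord0 i ^+ 2)); last first.
  by move=> i /negbTE ij; rewrite !mxE ij andbF mulr0 add0r.
set r := \sum_(_ < _ | _) _.
by rewrite /GRing.scale/=; field.
Unshelve. all: by end_near. Qed.

End vectors.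

(** * Expectations of finite sums and of shifted squares *)

Section expectations.
Context disp (Omega : measurableType disp) (R : realType).
Variable P : probability Omega R.

Lemma Lfun_sum_ord n (F : 'I_n -> Omega -> R) :
  (forall j, F j \in Lfun P 1) -> (fun w => \sum_(j < n) F j w) \in Lfun P 1.
Proof.
move=> F1; rewrite (_ : (fun _ => _) = \sum_(j < n) F j).
  by rewrite rpred_sum.
by apply/funext => w; rewrite fct_sumE.
Qed.

Lemma expectation_sum_ord n (F : 'I_n -> Omega -> R) :
    (forall j, F j \in Lfun P 1) ->
  'E_P[fun w => (\sum_(j < n) F j w)%R]%E = (\sum_(j < n) 'E_P[F j])%E.
Proof.
move=> F1.
rewrite (_ : (fun _ => _) = \sum_(f <- [seq F j | j <- index_enum 'I_n]) f).
  by rewrite expectation_sum ?big_map// => _ /mapP[j _ ->].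
by apply/funext => w; rewrite big_map fct_sumE.
Qed.

(** Bias-variance decomposition: the cross term carries the factor [E[U - m] = 0]. *)
Lemma expectation_sqr_shift (U : Omega -> R) (c m : R) :
    U \in Lfun P 2%:E -> 'E_P[U]%E = m%:E ->
  'E_P[fun w => ((c - U w) ^+ 2)%R]%E
    = ((c - m) ^+ 2)%:E + 'E_P[fun w => ((U w - m) ^+ 2)%R]%E.
Proof.
move=> U2 Um.
have Y2 : (fun w => 1 * U w + (- m) * cst 1 w) \in Lfun P 2%:E.
  by apply: Lfun_lin; rewrite ?ler1n ?Lfun_cst.
have Y0 : 'E_P[fun w => (1 * U w + (- m) * cst 1 w)%R]%E = 0%E.
  rewrite expectation_lin ?Lfun_cst// ?Lfun21// Um expectation_cst.
  by rewrite mul1e mule1 -EFinD subrr.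
have YE : (fun w => 1 * U w + (- m) * cst 1 w) = (fun w => U w - m).
  by apply/funext => w /=; ring.
rewrite YE in Y2 Y0.
have YY : (fun w => (U w - m) ^+ 2) \in Lfun P 1 by exact: Lfun2_mul_Lfun1.
rewrite (_ : (fun w => _) = fun w => (c - m) ^+ 2 * cst 1 w
    + 1 * (1 * (U w - m) ^+ 2 + (- 2 * (c - m)) * (U w - m))); last first.
  by apply/funext => w /=; ring.
rewrite expectation_lin ?Lfun_cst//; last first.
  by apply: Lfun_lin => //; rewrite Lfun21.
rewrite expectation_cst expectation_lin//; last by rewrite Lfun21.
by rewrite Y0 mule0 adde0 !mul1e mule1.
Qed.

End expectations.

(** * Independent identically distributed noise *)

Section iid_noise.
Context disp (Omega : measurableType disp) (R : realType).
Variables (P : probability Omega R) (d : nat) (X : nat -> Omega -> 'rV[R]_d).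
Hypothesis X_iid : iid_random_vectors P [set n | (1 <= n)%N] X.
Hypothesis X_L2 : ('E_P[fun w => (enorm (X 1%N w) ^+ 2)%R] < +oo)%E.

Let m := mean_vector P (X 1%N).
Let coord (j : 'I_d) k w := X k w ord0 j.
Let noise j k w := coord j k w - m ord0 j.

Let measurable_coord j k : (0 < k)%N -> measurable_fun [set: Omega] (coord j k).
Proof.
move=> k0; have [mX _ _] := X_iid.
apply: (@measurableT_comp _ _ _ _ (borel_rV R d) _
  (fun x : 'rV[R]_d => x ord0 j) _ (X k)); first exact: measurable_rV_coord.
exact: mX.
Qed.

Let measurable_shift (c : R) : measurable_fun [set: R] (fun x : R => x - c).
Proof. exact: measurable_funB. Qed.

Let measurable_noise j k : (0 < k)%N -> measurable_fun [set: Omega] (noise j k).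
Proof. by move=> k0; apply: measurable_funB => //; exact: measurable_coord. Qed.

Let measurable_coord_preimage j (A : set R) : measurable A ->
  measurable [set x : borel_rV R d | A (x ord0 j)].
Proof. by move=> mA; rewrite -[X in measurable X]setTI;
  exact: measurable_rV_coord. Qed.

Let coord_dist j k A : (0 < k)%N -> measurable A ->
  P (coord j k @^-1` A) = P (coord j 1 @^-1` A).
Proof.
move=> k0 mA; have [_ _ dX] := X_iid.
exact: (dX k 1%N k0 isT _ (measurable_coord_preimage j mA)).
Qed.

Let Lfun2_coord1 j : coord j 1 \in Lfun P 2%:E.
Proof.
apply: Lfun2P; first exact: measurable_coord.
apply: le_lt_trans X_L2; apply: expectation_le => //.
- by apply: measurable_funX; exact: measurable_coord.
- rewrite (_ : (fun _ => _) = fun w => \sum_(i < d) coord i 1 w ^+ 2).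
    by apply: measurable_sum => i; apply: measurable_funX;
      exact: measurable_coord.
  by apply/funext => w; rewrite enorm_sqr.
- by move=> w; rewrite sqr_ge0.
- by move=> w; rewrite sqr_ge0.
- apply/aeW => w; rewrite enorm_sqr (bigD1 j)//= lerDl.
  by rewrite sumr_ge0// => i _; rewrite sqr_ge0.
Qed.

Let Lfun2_coord j k : (0 < k)%N -> coord j k \in Lfun P 2%:E.
Proof.
move=> k0; apply: Lfun2P; first exact: measurable_coord.
rewrite (@eq_distribution_ge0_expectation _ _ _ P _ (coord j 1)
  (fun x => x ^+ 2)).
- by have /Lfun2_integrable_sqr/integrable_lty
    := Lfun2_coord1 j; rewrite unlock; apply.
- exact: measurable_coord.
- exact: measurable_coord.
- by move=> A mA; exact: coord_dist.
- exact: measurable_funX.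
- by move=> x; rewrite sqr_ge0.
Qed.

Let coord_mean1 j : 'E_P[coord j 1]%E = (m ord0 j)%:E.
Proof. by rewrite mxE fineK//;
  exact/expectation_fin_num/Lfun21/Lfun2_coord1. Qed.

Let coord_mean j k : (0 < k)%N -> 'E_P[coord j k]%E = (m ord0 j)%:E.
Proof.
move=> k0; rewrite -coord_mean1.
apply: (@eq_distribution_expectation _ _ _ P _ (coord j 1) id).
- exact: measurable_coord.
- exact: measurable_coord.
- by move=> A mA; exact: coord_dist.
- exact: measurable_id.
- by rewrite Lfun21 ?Lfun2_coord.
- by rewrite Lfun21 ?Lfun2_coord.
Qed.

Let Lfun2_noise j k : (0 < k)%N -> noise j k \in Lfun P 2%:E.
Proof.
move=> k0; rewrite (_ : noise j k
  = fun w => 1 * coord j k w + (- m ord0 j) * cst 1 w).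
  by apply: Lfun_lin; rewrite ?ler1n ?Lfun_cst ?Lfun2_coord.
by apply/funext => w; rewrite /noise/=; ring.
Qed.

Let noise_mean j k : (0 < k)%N -> 'E_P[noise j k]%E = 0%E.
Proof.
move=> k0; rewrite (_ : noise j k
  = fun w => 1 * coord j k w + (- m ord0 j) * cst 1 w).
  rewrite expectation_lin ?Lfun_cst ?Lfun21 ?Lfun2_coord// coord_mean//.
  by rewrite expectation_cst mul1e mule1 -EFinD subrr.
by apply/funext => w; rewrite /noise/=; ring.
Qed.

Definition coord_variance j :=
  fine 'E_P[fun w => ((X 1%N w ord0 j - m ord0 j) ^+ 2)%R]%E.

Let noise1_sqr j :
  'E_P[fun w => (noise j 1 w ^+ 2)%R]%E = (coord_variance j)%:E.
Proof.
rewrite fineK// expectation_fin_num//.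
by apply: Lfun2_mul_Lfun1; exact: Lfun2_noise.
Qed.

Let noise_variance j k : (0 < k)%N ->
  'E_P[noise j k \* noise j k]%E = (coord_variance j)%:E.
Proof.
move=> k0; rewrite -noise1_sqr.
apply: (@eq_distribution_ge0_expectation _ _ _ P (coord j k) (coord j 1)
  (fun x => (x - m ord0 j) ^+ 2)).
- exact: measurable_coord.
- exact: measurable_coord.
- by move=> A mA; exact: coord_dist.
- by apply: measurable_funX; exact: measurable_shift.
- by move=> x; rewrite sqr_ge0.
Qed.

Let noise_orthogonal j k l : (0 < k)%N -> (k < l)%N ->
  'E_P[noise j k \* noise j l]%E = 0%E.
Proof.
move=> k0 kl; have l0 := leq_ltn_trans (leq0n _) kl.
have [_ iX _] := X_iid.
rewrite expectationM_independent ?noise_mean ?mul0e//.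
- exact: measurable_noise.
- exact: measurable_noise.
- move=> A B mA mB.
  have mS C : measurable C ->
      measurable [set x : borel_rV R d | C (x ord0 j - m ord0 j)].
    move=> mC; apply: (@measurable_coord_preimage j [set y | C (y - m ord0 j)]).
    by rewrite -[X in measurable X]setTI; exact: measurable_shift.
  (* Independence takes one family of events over all indices: [A] is placed at [k], [B] elsewhere,
     both pulled back through the centred [j]-th coordinate. *)
  pose S i : set (borel_rV R d) :=
    [set x | (if i == k then A else B) (x ord0 j - m ord0 j)].
  have := iX [:: k; l] S.
  rewrite /= inE (ltn_eqF kl) => /(_ isT).
  have -> : \bigcap_(i in [set` [:: k; l]]) (X i @^-1` S i)
      = noise j k @^-1` A `&` noise j l @^-1` B.
    rewrite /S; apply/seteqP; split => w /=.
      move=> H; split.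
        by have := H k; rewrite /= eqxx; apply; rewrite inE eqxx.
      by have := H l; rewrite /= (gtn_eqF kl); apply; rewrite !inE eqxx orbT.
    move=> [Aw Bw] i /=; rewrite !inE => /orP[]/eqP ->.
      by rewrite eqxx.
    by rewrite (gtn_eqF kl).
  rewrite big_cons big_seq1 /S eqxx (gtn_eqF kl); apply.
    by move=> i; rewrite !inE => /orP[]/eqP ->.
  by move=> i _; case: ifPn => _; exact: mS.
- by rewrite Lfun21// Lfun2_noise.
- by rewrite Lfun21// Lfun2_noise.
- by rewrite Lfun2_mul_Lfun1// Lfun2_noise.
Qed.

(** The trace of the covariance matrix of [X 1]. *)
Definition total_variance := \sum_(j < d) coord_variance j.

Let sqr_distE (t : 'rV[R]_d) : (fun w => enorm (t - X 1%N w) ^+ 2)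
  = (fun w => \sum_(j < d) (t ord0 j - coord j 1 w) ^+ 2).
Proof.
apply/funext => w; rewrite enorm_sqr.
by apply: eq_bigr => j _; rewrite !mxE.
Qed.

Let Lfun_sqr_coord_dist (t : 'rV[R]_d) j :
  (fun w => (t ord0 j - coord j 1 w) ^+ 2) \in Lfun P 1.
Proof.
apply: Lfun2_mul_Lfun1;
rewrite (_ : (fun _ => _) = fun w => t ord0 j * cst 1 w + (-1) * coord j 1 w);
  do ?[by apply: Lfun_lin; rewrite ?ler1n ?Lfun_cst ?Lfun2_coord];
  by apply/funext => w /=; ring.
Qed.

Lemma Lfun_sqr_dist (t : 'rV[R]_d) :
  (fun w => enorm (t - X 1%N w) ^+ 2) \in Lfun P 1.
Proof. by rewrite sqr_distE Lfun_sum_ord. Qed.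

Lemma expectation_sqr_dist (t : 'rV[R]_d) :
  'E_P[fun w => (enorm (t - X 1%N w) ^+ 2)%R]%E
    = (enorm (t - m) ^+ 2 + total_variance)%:E.
Proof.
rewrite sqr_distE expectation_sum_ord//.
under eq_bigr => j _.
  rewrite (expectation_sqr_shift _ (Lfun2_coord1 j) (coord_mean1 j)).
  rewrite noise1_sqr -EFinD.
  over.
rewrite sumEFin big_split/= enorm_sqr; congr (_ + _)%:E.
by apply: eq_bigr => j _; rewrite !mxE.
Qed.

(** At [t = m] the distance identity makes the total variance equal to [E[|m - X_1|^2]]; were it 0,
    the integrand would vanish almost surely and [X 1] would equal its mean with probability 1. *)
Lemma total_variance_gt0 :
  (P [set w | X 1%N w = mean_vector P (X 1%N)] < 1)%E -> 0 < total_variance.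
Proof.
move=> nonconst.
have := expectation_sqr_dist m.
rewrite subrr (_ : enorm 0 ^+ 2 = 0) ?add0r;
  last by apply/eqP; rewrite enorm_eq0.
set h := (fun w => enorm (m - X 1%N w) ^+ 2) => hE.
have mh : measurable_fun [set: Omega] h.
  rewrite (_ : h = fun w => \sum_(j < d) noise j 1 w ^+ 2).
    by apply: measurable_sum => i; apply: measurable_funX;
      exact: measurable_noise.
  apply/funext => w; rewrite /h enorm_sqr.
  by apply: eq_bigr => j _; rewrite /noise /coord !mxE -sqrrN opprB.
have h0 w : 0 <= h w by rewrite sqr_ge0.
have : 0 <= total_variance by rewrite -lee_fin -hE expectation_ge0.
rewrite le_eqVlt => /predU1P[v0|//]; exfalso.
move: nonconst; rewrite ltNge => /negP; apply.
have -> : [set w | X 1%N w = m] = h @^-1` [set 0].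
  apply/seteqP; split => w /=; rewrite /h.
    by move=> ->; apply/eqP; rewrite subrr enorm_eq0.
  by move/eqP; rewrite enorm_eq0 subr_eq0 => /eqP.
have mS : measurable (h @^-1` [set 0]).
  by rewrite -[X in measurable X]setTI; apply: mh.
have : (\int[P]_(w in setT) `|(h w)%:E| = 0)%E.
  move: hE; rewrite -v0 unlock; apply: etrans; apply: eq_integral => w _.
  by rewrite gee0_abs// lee_fin.
have mEh : measurable_fun setT (EFin \o h) by exact/measurable_EFinP.
move=> /(ae_eq_integral_abs P measurableT mEh) [N [mN PN0 sub]].
(* The null set [N] contains every point with [h w <> 0], so its complement lies in the event and
   has full mass. *)
rewrite -(probability_setT P) -(setUv N).
apply: (le_trans (measureU2 _ mN (measurableC mN))).
rewrite [X in (X + _)%E]PN0 add0e; apply: le_measure; rewrite ?inE//.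
  exact: measurableC.
move=> w Nw; apply: contrapT => hw; apply: Nw; apply: sub => /= H.
by have := H I => -[].
Qed.

(** * Mean squared error of the iterates *)

Section recursion.
Variables (b : nat -> R) (xi : 'rV[R]_d) (Theta : nat -> Omega -> 'rV[R]_d).
Hypothesis Theta0 : forall w, Theta 0%N w = xi.
Hypothesis ThetaS : forall n w,
  Theta n.+1 w = Theta n w - b n.+1 *: (Theta n w - X n.+1 w).

(** The iteration decouples into coordinates sharing the step sizes; the scalar recursions are
    linear, so their sum obeys the same recursion with the variances added. *)
Lemma expectation_sqr_error : exists e : nat -> R,
  [/\ e 0%N = enorm (xi - m) ^+ 2,
      forall n, e n.+1 = (1 - b n.+1) ^+ 2 * e n
                         + b n.+1 ^+ 2 * total_variance,
      forall n, (fun w => enorm (Theta n w - m) ^+ 2) \in Lfun P 1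
    & forall n, 'E_P[fun w => (enorm (Theta n w - m) ^+ 2)%R]%E = (e n)%:E].
Proof.
pose ej j n := iteri n (fun k x => (1 - b k.+1) ^+ 2 * x
  + b k.+1 ^+ 2 * coord_variance j) ((xi ord0 j - m ord0 j) ^+ 2).
pose D j n w := Theta n w ord0 j - m ord0 j.
have DE j n : D j n \in Lfun P 2%:E /\ 'E_P[D j n \* D j n]%E = (ej j n)%:E.
  apply: (@second_moment_recursion _ _ _ P b (coord_variance j)
    (xi ord0 j - m ord0 j) (ej j) (D j) (noise j)) => //.
  - by move=> k k0; exact: Lfun2_noise.
  - by move=> k k0; exact: noise_mean.
  - by move=> k k0; exact: noise_variance.
  - by move=> k l k0 kl; exact: noise_orthogonal.
  - by move=> w; rewrite /D Theta0.
  - move=> k w; rewrite /D ThetaS /noise /coord !mxE; ring.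
have hE n : (fun w => enorm (Theta n w - m) ^+ 2)
    = (fun w => \sum_(j < d) (D j n \* D j n) w).
  apply/funext => w; rewrite enorm_sqr; apply: eq_bigr => j _.
  by rewrite /= /D !mxE expr2.
have DD j n : D j n \* D j n \in Lfun P 1.
  by have [D2 _] := DE j n; exact: Lfun2_mul_Lfun1.
exists (fun n => \sum_(j < d) ej j n); split => [|n|n|n].
- by rewrite enorm_sqr; apply: eq_bigr => j _; rewrite /ej /= !mxE.
- by rewrite /total_variance !mulr_sumr -big_split.
- by rewrite hE Lfun_sum_ord.
- rewrite hE expectation_sum_ord// -sumEFin.
  by apply: eq_bigr => j _; case: (DE j n).
Qed.

End recursion.
End iid_noise.

(** * Minimiser of the quadratic risk and transfer of the scalar rates *)

Theorem theorem1p1 (R : realType) (d : nat) (alpha gamma nu : R)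
    (xi : 'rV[R]_d)
    (disp : measure_display) (Omega : measurableType disp)
    (P : probability Omega R)
    (X : nat -> Omega -> 'rV[R]_d)
    (F : 'rV[R]_d -> 'rV[R]_d -> R) (f : 'rV[R]_d -> R)
    (Theta : nat -> Omega -> 'rV[R]_d)
    (d_gt0 : (0 < d)%N)
    (alpha_gt0 : 0 < alpha) (gamma_gt0 : 0 < gamma) (nu_gt0 : 0 < nu)
    (X_iid : iid_random_vectors P [set n | (1 <= n)%N] X)
    (X_L2 : ('E_P[fun w => (enorm (X 1%N w) ^+ 2)%R] < +oo)%E)
    (X_nonconst : (P [set w | X 1%N w = mean_vector P (X 1%N)] < 1)%E)
    (FE : forall theta x : 'rV[R]_d,
      F theta x = alpha / 2 * enorm (theta - x) ^+ 2)
    (fE : forall theta : 'rV[R]_d,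
      ((f theta)%:E = 'E_P[fun w => F theta (X 1%N w)])%E)
    (Theta_rv : forall n : nat, random_vector (Theta n))
    (Theta0 : forall w : Omega, Theta 0%N w = xi)
    (ThetaS : forall (n : nat) (w : Omega), (1 <= n)%N ->
      Theta n w = Theta n.-1 w
        - (gamma / n%:R `^ nu)
            *: gradient (fun theta => F theta (X n w)) (Theta n.-1 w)) :
  (exists! vtheta : 'rV[R]_d,
     [set theta | f theta = inf [set f w | w in [set: 'rV[R]_d]]]
       = [set vtheta]) /\
  (forall vtheta : 'rV[R]_d,
     [set theta | f theta = inf [set f w | w in [set: 'rV[R]_d]]]
       = [set vtheta] ->
     (forall eps : R, 0 < eps ->
        exists c0 c1 : R, [/\ 0 < c0, 0 < c1 &
          forall n : nat, (1 <= n)%N ->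
            ((c0 * n%:R `^ (- rate alpha gamma nu eps 0))%:E
               <= 'E_P[fun w => (enorm (Theta n w - vtheta) ^+ 2)%R]
                    `^ (1 / 2)%R)%E /\
            ('E_P[fun w => (enorm (Theta n w - vtheta) ^+ 2)%R] `^ (1 / 2)%R
               <= (c1 * n%:R `^ (- rate alpha gamma nu eps 1))%:E)%E]) /\
     (forall eps : R, 0 < eps ->
        exists C0 C1 : R, [/\ 0 < C0, 0 < C1 &
          forall n : nat, (1 <= n)%N ->
            ((C0 * n%:R `^ (- (2 * rate alpha gamma nu eps 0)))%:E
               <= 'E_P[fun w => f (Theta n w)] - (f vtheta)%:E)%E /\
            ('E_P[fun w => f (Theta n w)] - (f vtheta)%:E
               <= (C1 * n%:R `^ (- (2 * rate alpha gamma nu eps 1)))%:E)%E])).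
Proof.
pose m := mean_vector P (X 1%N); pose s := total_variance P X.
have s0 : 0 < s by exact: total_variance_gt0.
have fm theta : f theta = alpha / 2 * enorm (theta - m) ^+ 2 + alpha / 2 * s.
  apply: EFin_inj; rewrite fE.
  have := expectation_sqr_dist X_iid X_L2 theta.
  rewrite -/m -/s -mulrDr EFinM => <-.
  rewrite -expectationZl ?Lfun_sqr_dist//.
  by congr expectation; apply/funext => w /=; rewrite FE mulrC.
have f_min theta : f m <= f theta.
  rewrite !fm subrr lerD2r ler_wpM2l ?divr_ge0 ?(ltW alpha_gt0)//.
  by rewrite [leLHS](_ : _ = 0) ?sqr_ge0//; apply/eqP; rewrite enorm_eq0.
have infE : inf [set f w | w in [set: 'rV[R]_d]] = f m.
  apply/eqP; rewrite eq_le; apply/andP; split.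
    apply: ge_inf; last by exists m.
    by exists (f m) => _ [theta _ <-].
  by apply: lb_le_inf; [exists (f m), m|move=> _ [theta _ <-]].
have argminE : [set theta | f theta = inf [set f w | w in [set: 'rV[R]_d]]]
    = [set m].
  rewrite infE; apply/seteqP; split => theta /=; last by move=> ->.
  rewrite !fm subrr => /addIr.
  have -> : enorm (0 : 'rV[R]_d) ^+ 2 = 0 by apply/eqP; rewrite enorm_eq0.
  move/eqP; rewrite mulr0 mulf_eq0 gt_eqF ?divr_gt0//=.
  by rewrite enorm_eq0 subr_eq0 => /eqP.
(* Settles uniqueness and also lets the arbitrary [vtheta] of the rate statements be replaced by
   [m]. *)
have argmin_unique v :
    [set theta | f theta = inf [set f w | w in [set: 'rV[R]_d]]] = [set v] ->
    m = v.
  by rewrite argminE => mv; have : [set v] m by rewrite -mv.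
split; first by exists m; split => // v /argmin_unique.
move=> _ /argmin_unique <-.
pose b n := gamma * alpha / n%:R `^ nu.
have ThetaS' n w :
    Theta n.+1 w = Theta n w - b n.+1 *: (Theta n w - X n.+1 w).
  rewrite ThetaS//= (_ : (fun theta => _)
    = (fun theta => alpha / 2 * enorm (theta - X n.+1 w) ^+ 2)); last first.
    by apply/funext => theta; rewrite FE.
  by rewrite gradient_sqr_dist scalerA mulrAC.
have [e [e0 eS eL eE]] := expectation_sqr_error X_iid X_L2 Theta0 ThetaS'.
(* The [eq_ind_r] term transports nonnegativity of a square along [e0] to give [0 <= e 0]. *)
have rates eps : 0 < eps -> _ := fun eps0 => recursion_rate alpha_gt0 gamma_gt0
  nu_gt0 s0 (eq_ind_r (fun x => 0 <= x) (sqr_ge0 _) e0) eps0 eS.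
split=> eps /rates[c0 [c1 [c0_gt0 c1_gt0 ce]]].
  (* The root halves the exponent and turns each constant into its square root, the witnesses
     below. *)
  have sqrtE (c r : R) (n : nat) : 0 < c ->
      (c * n%:R `^ (- (2 * r))) `^ (1 / 2) = c `^ (1 / 2) * n%:R `^ (- r).
    move=> c_gt0; rewrite powRM ?powR_ge0 ?(ltW c_gt0)// -powRrM.
    by congr (_ * _ `^ _); field.
  exists (c0 `^ (1 / 2)), (c1 `^ (1 / 2)); split; rewrite ?powR_gt0// => n n0.
  have [lo up] := ce n n0.
  have e_ge0 : 0 <= e n.
    by apply: le_trans lo; rewrite mulr_ge0 ?powR_ge0 ?(ltW c0_gt0).
  rewrite eE poweR_EFin !lee_fin -!sqrtE//.
  by split; apply: ge0_ler_powR => //;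
    rewrite nnegrE ?mulr_ge0 ?powR_ge0 ?(ltW c0_gt0) ?(ltW c1_gt0).
(* The irreducible risk [alpha / 2 * s] occurs in both terms and cancels. *)
have fThetaE n : ('E_P[fun w => f (Theta n w)] - (f m)%:E)%E
    = (alpha / 2 * e n)%:E.
  rewrite (_ : (fun w => _) = fun w => alpha / 2 * enorm (Theta n w - m) ^+ 2
      + (alpha / 2 * s) * cst 1 w); last first.
    by apply/funext => w; rewrite fm mulr1.
  rewrite expectation_lin ?Lfun_cst// eE expectation_cst mule1 -!EFinM.
  rewrite fm subrr (_ : enorm 0 ^+ 2 = 0); last by apply/eqP; rewrite enorm_eq0.
  by rewrite mulr0 add0r -EFinD addrK.
have a2 : 0 < alpha / 2 by rewrite divr_gt0.
exists (alpha / 2 * c0), (alpha / 2 * c1); split; rewrite ?mulr_gt0// => n n0.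
have [lo up] := ce n n0.
by rewrite fThetaE !lee_fin -!mulrA !ler_wpM2l// ltW.
Qed.
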